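(* Assume that for all $x\in\mathbb{T}$ and $l\in\{2,3\}$, $|x-B_1|<|x-B_l|$ implies $c_1(x)<c_l(x)$. Then, almost surely, $$\lim_{n\to\infty}\frac{\rho_n}{n}=\lim_{n\to\infty}\frac{\overline{\rho}_n}{n}=\gamma ,\qquad \gamma=\int_{\mathbb{T}_1}c(x)\,dx .$$
   Context: Identify the plane with $\mathbb{C}$. Set $\lambda=2(3\sqrt3)^{-1/2}$, $i=\sqrt{-1}$, $j=e^{2i\pi/3}$, $B_2=\lambda i$, $B_1=j^2B_2$, $B_3=jB_2$, and let $\mathbb{T}\subset\mathbb{C}$ be the (closed, filled) equilateral triangle with vertices $B_1,B_2,B_3$; it has unit area. $|\cdot|$ is the Euclidean norm, $dx$ is Lebesgue measure. Let $D_1=\{ijt: t<0\}$ and, for $l=2,3$, $D_l=\{ij^lt: t\le 0\}$; the cells $\mathbb{T}_l=\{x\in\mathbb{T}: |x-B_l|=\min_{1\le m\le 3}|x-B_m|\}\setminus D_l$, $l=1,2,3$, form a partition of $\mathbb{T}$. The cost function $c:\mathbb{T}\to[0,\infty)$ is measurable with $\|c\|_\infty=\sup_{x\in\mathbb{T}}c(x)<\infty$; put $c_1(x)=c(x)$, $c_2(x)=c(j^2x)$, $c_3(x)=c(jx)$. $X_1,X_2,\ldots$ are independent random variables uniformly distributed on $\mathbb{T}$. Let $\mathcal{A}_n$ be the set of matrices $A=(a_{kl})_{1\le k\le n,\,1\le l\le 3}$ with $a_{kl}\in\{0,1\}$ and $a_{k1}+a_{k2}+a_{k3}=1$ for every $k$.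 Define $\rho_n(A)=\max_{1\le l\le3}\sum_{k=1}^n a_{kl}c_l(X_k)$, the optimal load $\rho_n=\min_{A\in\mathcal{A}_n}\rho_n(A)$, and the suboptimal load $\overline{\rho}_n=\rho_n(\overline A)$, where $\overline A=(\overline a_{kl})$ with $\overline a_{kl}=\mathbf{1}(X_k\in\mathbb{T}_l)$. *)

(* Defs.v *)
From HB Require Import structures.
From mathcomp Require Import all_boot all_order all_algebra.
From mathcomp Require Import all_classical all_reals all_analysis.
From mathcomp Require Import complex.

Set Implicit Arguments.
Unset Strict Implicit.
Unset Printing Implicit Defensive.

Import Order.TTheory GRing.Theory Num.Theory.
Import numFieldNormedType.Exports.

Local Open Scope classical_set_scope.
Local Open Scope complex_scope.
Local Open Scope ring_scope.

(* Points of the plane are pairs of reals, so that the library's product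
   sigma-algebra and product measure apply; the geometry is done in R[i] through
   [toC] and [ofC].  The indices 1, 2, 3 are the elements 0, 1, 2 of 'I_3. *)

Notation plane R := (measurableTypeR R * measurableTypeR R)%type.

Definition area {R : realType} : {measure set (plane R) -> \bar R} :=
  (lebesgue_measure \x lebesgue_measure)%E.

Section Triangle.
Context {R : realType}.
Implicit Types (x : plane R) (l m : 'I_3).

Definition toC x : R[i] := x.1 +i* x.2.
Definition ofC (z : R[i]) : plane R := (complex.Re z, complex.Im z).

Definition lambda : R := 2 * (Num.sqrt (3 * Num.sqrt 3))^-1.
Definition j : R[i] := cos (2 * pi / 3) +i* sin (2 * pi / 3).

Definition B2 : R[i] := lambda%:C * 'i%C.
Definition B l : R[i] := [:: j ^+ 2 * B2; B2; j * B2]`_l.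

Definition triangle : set (plane R) :=
  [set x | exists w : 'I_3 -> R,
     [/\ forall l, 0 <= w l, \sum_l w l = 1 & toC x = \sum_l (w l)%:C * B l]].

Definition dist x l : R := complex.Re `|toC x - B l|.

(* Removing [ray l] breaks ties between equidistant vertices; ray 0 omits the
   origin, which therefore belongs to cell 0 only, and the cells partition the
   triangle. *)
Definition ray l : set (plane R) :=
  [set x | exists t : R, (if l == 0 then t < 0 else t <= 0)
                         /\ toC x = 'i%C * j ^+ l.+1 * t%:C].

(* The initial value of a [\big[Num.min/_]] or [\big[Num.max/_]] below is always
   one of the values ranged over, so the result is the plain minimum or maximum. *)
Definition cell l : set (plane R) :=
  [set x | triangle x /\ dist x l = \big[Num.min/dist x 0]_m dist x m]
    `\` ray l.

Definition cost (c : plane R -> R) l x : R :=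
  c (ofC ([:: 1; j ^+ 2; j]`_l * toC x)).

End Triangle.

Section Loads.
Context {R : realType} (c : plane R -> R) (x : nat -> plane R) (n : nat).

Definition assignments : {set 'M[bool]_(n, 3)} :=
  [set A : 'M[bool]_(n, 3) | [forall k, (\sum_l (A k l : nat) == 1)%N]].

Definition load (A : 'M[bool]_(n, 3)) (l : 'I_3) : R :=
  \sum_(k < n) (A k l)%:R * cost c l (x k).

Definition max_load (A : 'M[bool]_(n, 3)) : R :=
  \big[Num.max/load A 0]_(l < 3) load A l.

Definition all_to_first : 'M[bool]_(n, 3) := \matrix_(k, l) (l == 0).

Lemma all_to_first_assignment : all_to_first \in assignments.
Proof.
by rewrite inE; apply/forallP => k; rewrite !big_ord_recl big_ord0 !mxE.
Qed.

Definition opt_load : R :=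
  \big[Num.min/max_load all_to_first]_(A in assignments) max_load A.

Definition cell_assignment : 'M[bool]_(n, 3) :=
  \matrix_(k, l) (x k \in cell l).

Definition subopt_load : R := max_load cell_assignment.

End Loads.

Section Sampling.
Context d {Omega : measurableType d} {R : realType} (P : probability Omega R).

Definition uniform_on (D : set (plane R)) (X : {RV P >-> plane R}) :=
  forall E, measurable E -> P (X @^-1` E) = (area (E `&` D) / area D)%E.

Definition mutually_independent d' (T : measurableType d')
    (X : nat -> {RV P >-> T}) :=
  forall (s : seq nat) (E : nat -> set T),
    uniq s -> (forall k, measurable (E k)) ->
    P (\bigcap_(k in [set` s]) (X k @^-1` E k))
      = (\prod_(k <- s) P (X k @^-1` E k))%E.

End Sampling.

(* Main.v *)
From HB Require Import structures.
Require Import Defs.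
From mathcomp Require Import all_boot all_order all_algebra.
From mathcomp Require Import all_classical all_reals all_analysis.
From mathcomp Require Import measurable_realfun complex ring lra zify.
Import Order.TTheory GRing.Theory Num.Theory.
Import numFieldNormedType.Exports.
Local Open Scope classical_set_scope.
Local Open Scope ring_scope.

(** Each assignment has a largest load at least one third of its total load.
    The total load is smallest when every sample point goes to the server which
    it costs least. By hypothesis the first server is the cheapest one for a
    point strictly nearest to the first vertex, and rotating by [2 pi / 3] gives
    the same for the other two servers: so the assignment by cells has the least
    total load, as long as no point is equidistant from two vertices
    ([load_bounds]). Such ties lie on three lines and have probability 0
    ([ae_untied_triangle]). Hence, almost surely, the optimal load lies between
    the mean and the maximum of the three loads of the assignment by cells.

    Those three loads are sums of bounded, independent and identically
    distributed variables. Rotations preserve the area, the triangle and, up to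
    the ties, permute the cells, and the triangle has area 1; so all three have
    the same expectation, the integral of [c] over the first cell
    ([expectation_cell_cost]). By the strong law of large numbers ([iid_slln])
    the three loads divided by [n] converge to it, and so do the two quantities
    squeezed between their mean and their maximum.

    The strong law is proved for bounded variables by second moments: the means
    along the squares [n = k ^ 2] have variances of order [1 / k ^ 2], which are
    summable, and bounded increments fill the gaps between squares
    ([orthogonal_slln]). Rotation invariance of the area follows from the
    principle of Cavalieri, because a rotation is a product of three shears
    ([area_rot]). *)

(** * Strong law of large numbers for bounded, pairwise orthogonal variables *)

Lemma between_squares (n : nat) : exists r, (r ^ 2 <= n < r.+1 ^ 2)%N.
Proof.
elim: n => [|n [r /andP[rn nr]]]; first by exists 0.
have [le|lt] := leqP (r.+1 ^ 2) n.+1; first by exists r.+1; nia.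
by exists r; nia.
Qed.

(** By telescoping, as [1 / x ^ 2 <= 2 (1 / x - 1 / (x + 1))] for [1 <= x]. *)
Lemma sum_inv_square_le (R : realFieldType) (n : nat) :
  \sum_(0 <= k < n) (k.+1%:R ^+ 2)^-1 <= 2 * (1 - n.+1%:R^-1) :> R.
Proof.
elim: n => [|n IH]; first by rewrite big_geq// invr1 subrr mulr0.
rewrite big_nat_recr //=; apply: (le_trans (lerD IH (lexx _))).
set x : R := n.+1%:R; have x1 : 1 <= x by rewrite ler1n.
rewrite -[n.+2%:R]natr1 -/x -subr_ge0.
have -> : 2 * (1 - (x + 1)^-1) - (2 * (1 - x^-1) + (x ^+ 2)^-1)
    = (x - 1) / (x ^+ 2 * (x + 1)) by field; apply/andP; split; lra.
by apply: divr_ge0; nra.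
Qed.

(** Between two consecutive squares [r ^ 2] and [(r + 1) ^ 2] there are about
    [2 r] integers, so bounded increments move [u] by [O(r)] only, which is
    negligible when divided by [r ^ 2]. *)
Lemma cvg_mean_from_squares (R : realType) (u : nat -> R) (M : R) :
  (forall n, `|u n.+1 - u n| <= M) ->
  (fun k => u (k.+1 ^ 2)%N / k.+1%:R ^+ 2) @ \oo --> 0 ->
  (fun n => u n / n%:R) @ \oo --> 0.
Proof.
move=> uM /cvgr0Pnorm_le u2; apply/cvgr0Pnorm_le => e e0.
have M0 : 0 <= M by apply: le_trans (uM 0).
have incr m p : `|u (m + p)%N - u m| <= p%:R * M.
  elim: p => [|p IH]; first by rewrite addn0 subrr normr0 mul0r.
  rewrite addnS -(subrK (u (m + p)%N) (u _)) -addrA.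
  rewrite (le_trans (ler_normD _ _))//.
  by rewrite -natr1 mulrDl mul1r [leRHS]addrC lerD// uM.
have [N _ NP] := u2 _ (divr_gt0 e0 (ltr0Sn _ 1)).
(* Beyond [K ^ 2] the increments since the last square, at most [2 x M] in all,
   are at most [e / 2] after division by [n >= x ^ 2]. *)
have [K KP] : exists K : nat, 4 * M / e <= K%:R.
  exists (Num.bound (4 * M / e)); apply/ltW; apply: archi_boundP.
  by rewrite divr_ge0 ?mulr_ge0// ltW.
exists ((maxn N K).+1 ^ 2)%N => // n /= nNK.
have [[|r] /andP[rn nr]] := between_squares n; first by lia.
have rNK : (maxn N K <= r)%N by nia.
have Nr : (N <= r)%N by lia.
have Kr : (K <= r)%N by lia.
set x : R := r.+1%:R; have x0 : 0 < x by rewrite ltr0Sn.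
have xn : x ^+ 2 <= n%:R by rewrite -natrX ler_nat.
have n0 : 0 < n%:R :> R by apply: lt_le_trans xn; rewrite exprn_gt0.
have /= := NP r Nr.
rewrite !normrM !normfV (ger0_norm (ltW n0)) (ger0_norm (exprn_ge0 2 (ltW x0))).
rewrite ler_pdivrMr ?exprn_gt0// -/x => ur.
rewrite ler_pdivrMr//.
rewrite -(subnKC rn).
set p := (n - _)%N.
have px : p%:R <= 2 * x.
  by rewrite /x -natrM ler_nat /p; move: nr; rewrite -!mulnn; nia.
have := incr (r.+1 ^ 2)%N p; set a := u _; set b := u _ => ab.
have ba : `|a| <= `|b| + p%:R * M.
  by rewrite -[a](subrK b) addrC (le_trans (ler_normD _ _))// lerD.
rewrite (subnKC rn).
have Mx : 4 * M <= e * x.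
  have : 4 * M / e <= x by rewrite (le_trans KP)// ler_nat leqW.
  by rewrite ler_pdivrMr// [x * e]mulrC.
apply: (le_trans ba).
have : e * x ^+ 2 <= e * n%:R by rewrite ler_pM2l.
have : p%:R * M <= 2 * x * M by rewrite ler_wpM2r.
rewrite -/b in ur; nra.
Qed.

Lemma bounded_integrable d (T : measurableType d) (R : realType)
    (P : probability T R) (f : T -> R) (M : R) :
  measurable_fun setT f -> (forall w, `|f w| <= M) ->
  P.-integrable setT (EFin \o f).
Proof.
move=> mf fM; apply: measurable_bounded_integrable => //.
  by rewrite (le_lt_trans (probability_le1 P measurableT))// ltry.
exists M; split; first by rewrite num_real.
by move=> x Mx w _ /=; rewrite (le_trans (fM w))// ltW.
Qed.

Section OrthogonalSLLN.
Context d (T : measurableType d) (R : realType) (P : probability T R).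
Variables (Y : nat -> T -> R) (M : R).
Hypothesis mY : forall k, measurable_fun setT (Y k).
Hypothesis YM : forall k w, `|Y k w| <= M.
Hypothesis Y_orth : forall i k, i != k -> (\int[P]_w (Y i w * Y k w)%:E = 0)%E.

Let S n w := \sum_(k < n) Y k w.

Let mS n : measurable_fun setT (S n).
Proof. by apply: measurable_sum => k; exact: mY. Qed.

Let M_ge0 : 0 <= M.
Proof. exact: le_trans (normr_ge0 _) (YM 0%N point). Qed.

Let integrable_YY i k : P.-integrable setT (fun w => (Y i w * Y k w)%:E).
Proof.
apply: (@bounded_integrable _ _ _ _ (fun w => Y i w * Y k w) (M * M)).
  exact: measurable_funM.
by move=> w; rewrite normrM ler_pM.
Qed.

(** Orthogonality kills the cross terms of the expanded square. *)
Lemma orthogonal_sum_moment2 n :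
  (\int[P]_w ((S n w) ^+ 2)%:E <= (n%:R * M ^+ 2)%:E)%E.
Proof.
have -> : (\int[P]_w ((S n w) ^+ 2)%:E
    = \sum_(i < n) \sum_(k < n) \int[P]_w (Y i w * Y k w)%:E)%E.
  transitivity (\int[P]_w (\sum_(i < n) \sum_(k < n) (Y i w * Y k w)%:E))%E.
    apply: eq_integral => w _; rewrite expr2 /S big_distrl -sumEFin.
    by apply: eq_bigr => i _; rewrite big_distrr -sumEFin.
  rewrite integral_sum//; last by move=> i; exact: integrable_sum.
  by apply: eq_bigr => i _; rewrite integral_sum.
rewrite (_ : n%:R * M ^+ 2 = \sum_(i < n) M ^+ 2); last first.
  by rewrite sumr_const card_ord mulr_natl.
rewrite -sumEFin; apply: lee_sum => i _.
rewrite (bigD1 i)//= big1 ?adde0; last first.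
  by move=> k ki; rewrite Y_orth// eq_sym.
apply: (@le_trans _ _ (\int[P]_w (M ^+ 2)%:E)%E).
  apply: ge0_le_integral => //.
  - by move=> w _; rewrite lee_fin -expr2 sqr_ge0.
  - by apply/measurable_EFinP; exact: measurable_funM.
  - move=> w _; rewrite lee_fin -expr2 -[leLHS]real_normK ?num_real//.
    by rewrite lerXn2r ?nnegrE.
by rewrite integral_cst//= probability_setT mule1.
Qed.

(** The means along the squares have second moments summing to at most
    [2 M ^ 2], so almost surely the sum of their squares is finite. *)
Lemma orthogonal_slln :
  {ae P, forall w, (fun n => (\sum_(k < n) Y k w) / n%:R) @ \oo --> 0}.
Proof.
pose V k w := (S (k.+1 ^ 2) w / k.+1%:R ^+ 2) ^+ 2.
have V0 k w : (0 <= (V k w)%:E)%E by rewrite lee_fin sqr_ge0.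
have mV k : measurable_fun setT (EFin \o V k).
  by apply/measurable_EFinP; apply: measurable_funX; apply: measurable_funM.
have EV k : (\int[P]_w (V k w)%:E <= (M ^+ 2 * (k.+1%:R ^+ 2)^-1)%:E)%E.
  have -> : (\int[P]_w (V k w)%:E =
      ((k.+1%:R ^+ 4)^-1)%:E * \int[P]_w ((S (k.+1 ^ 2) w) ^+ 2)%:E)%E.
    rewrite -ge0_integralZl_EFin//; last 2 first.
    - by move=> w _; rewrite lee_fin sqr_ge0.
    - by apply/measurable_EFinP; exact: measurable_funX.
    apply: eq_integral => w _; rewrite /V -EFinM; congr EFin.
    by rewrite expr_div_n -exprM mulrC.
  apply: (le_trans (lee_wpmul2l _ (orthogonal_sum_moment2 _))).
    by rewrite lee_fin invr_ge0 exprn_ge0.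
  rewrite -EFinM lee_fin natrX le_eqVlt; apply/orP; left; apply/eqP.
  by field; rewrite addrC natr1 pnatr_eq0.
have intV : (\int[P]_w (\sum_(k <oo) (V k w)%:E) < +oo)%E.
  rewrite integral_nneseries//; apply: (@le_lt_trans _ _ (M ^+ 2 * 2)%:E);
    last by rewrite ltry.
  apply: lime_le.
    by apply: is_cvg_nneseries => k _ _; exact: integral_ge0.
  near=> n; apply: (le_trans (lee_sum _ (fun k _ => EV k))).
  rewrite sumEFin lee_fin -mulr_sumr ler_wpM2l ?sqr_ge0//.
  apply: (le_trans (sum_inv_square_le R n)).
  by rewrite ler_piMr// gerBl.
have iV : P.-integrable setT (fun w => \sum_(k <oo) (V k w)%:E)%E.
  apply/integrableP; split.
    apply: (ge0_emeasurable_sum (P := predT)) => // k _; exact: mV.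
  under eq_integral => w _ do rewrite gee0_abs ?nneseries_ge0//.
  exact: intV.
have := integrable_ae measurableT iV; apply: filterS => w /(_ I) Vfin.
apply: (@cvg_mean_from_squares _ (S^~ w) M) => [n|].
  by rewrite /S big_ord_recr /= addrC addrK.
suff : (fun k => V k w) @ \oo --> 0.
  move/cvgr0Pnorm_le => V_cvg; apply/cvgr0Pnorm_le => e e0.
  have := V_cvg _ (exprn_gt0 2 e0); apply: filterS => k /=.
  by rewrite /V normrX ler_pXn2r ?nnegrE ?(ltW e0).
apply: cvg_series_cvg_0; apply: nondecreasing_is_cvgn.
  apply/nondecreasing_seqP => n; rewrite /series /= big_nat_recr//= lerDl.
  exact: sqr_ge0.
exists (fine (\sum_(k <oo) (V k w)%:E)%E) => _ [n _ <-].
rewrite -lee_fin fineK// /series /= -sumEFin.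
exact: nneseries_lim_ge.
Unshelve. all: by end_near.
Qed.

End OrthogonalSLLN.

(** * Independent identically distributed samples *)

Section IndependentSamples.
Context d (Omega : measurableType d) (R : realType) (P : probability Omega R).
Context d' (T : measurableType d').
Variable X : nat -> {RV P >-> T}.
Hypothesis X_indep : mutually_independent X.

Let pairX i k w := (X i w, X k w).

Let mpairX i k : measurable_fun setT (pairX i k).
Proof. by apply: measurable_fun_pair; exact: measurable_funPT. Qed.

(** Independence gives the product rule on rectangles, and a measure on a
    product is determined by its values there. *)
Lemma independent_pair_law i k : i != k ->
  forall E : set (T * T), measurable E ->
  (distribution P (X i) \x distribution P (X k))%E E
  = pushforward P (pairX i k) E.
Proof.
move=> ik E mE.
pose pk : {mfun Omega >-> (T * T)%type} :=
  HB.pack (pairX i k) (isMeasurableFun.Build _ _ _ _ _ (mpairX i k)).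
apply: (@product_measure_unique _ _ _ _ _ (distribution P (X i))
  (distribution P (X k)) (distribution P pk)) => // A B mA mB.
pose F n := if n == i then A else B.
have /(_ [:: i; k] F) := X_indep.
rewrite /= inE ik => /(_ isT) H.
have {}H := H (fun n => ltac:(by rewrite /F; case: ifP)).
move: H; rewrite !big_cons big_nil mule1 {2 3}/F eqxx eq_sym (negbTE ik) => <-.
rewrite /distribution /pushforward; congr (P _).
apply/seteqP; split => w /=.
  move=> [Aw Bw] n /=; rewrite !inE /F => /orP[/eqP ->|/eqP ->].
    by rewrite eqxx.
  by rewrite eq_sym (negbTE ik).
move=> H; split.
  by have := H i; rewrite /= inE eqxx /F eqxx; apply.
by have := H k; rewrite /= !inE eqxx orbT /F eq_sym (negbTE ik); apply.
Qed.

(** By Fubini the mixed moment factors into a product of means, one of which is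
    zero. *)
Lemma independent_orthogonal (f : T -> R) (M : R) i k :
  measurable_fun setT f -> (forall x, `|f x| <= M) -> i != k ->
  (\int[P]_w (f (X i w))%:E = 0)%E ->
  (\int[P]_w (f (X i w) * f (X k w))%:E = 0)%E.
Proof.
move=> mf fM ik f0.
pose g (z : T * T) : \bar R := (f z.1 * f z.2)%:E.
have mg : measurable_fun setT g.
  by apply/measurable_EFinP; apply: measurable_funM; exact: measurableT_comp.
pose pk : {mfun Omega >-> (T * T)%type} :=
  HB.pack (pairX i k) (isMeasurableFun.Build _ _ _ _ _ (mpairX i k)).
have ig : P.-integrable setT (g \o pk).
  apply: (@bounded_integrable _ _ _ _ (fun w => f (X i w) * f (X k w)) (M * M)).
    by apply: measurable_funM; apply: measurableT_comp.
  by move=> w; rewrite normrM ler_pM.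
have -> : (\int[P]_w (f (X i w) * f (X k w))%:E
    = \int[distribution P (X i) \x distribution P (X k)]_z g z)%E.
  rewrite (@eq_measure_integral _ _ _ _ (distribution P pk)); last first.
    by move=> E mE _; exact: (independent_pair_law i k).
  by rewrite integral_distribution.
have igx : (distribution P (X i) \x distribution P (X k))%E.-integrable setT g.
  apply: (@measurable_bounded_integrable _ _ _ _
    (fun z => f z.1 * f z.2)) => //.
  - rewrite [X in (X < _)%E](independent_pair_law _ _ ik _ measurableT).
    by rewrite (le_lt_trans (probability_le1 P measurableT))// ltry.
  - exact/measurable_EFinP.
  - exists (M * M); split; first by rewrite num_real.
    by move=> x Mx z _ /=; rewrite normrM (le_trans _ (ltW Mx))// ler_pM.
rewrite -integral21_prod_meas1//.
apply: integral0_eq => y _; rewrite /fubini_G.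
under eq_integral do rewrite /g /= mulrC EFinM.
rewrite integralZl//; last first.
  exact: (bounded_integrable _ _ _ (distribution P (X i)) _ _ mf fM).
rewrite (@integral_distribution _ _ _ _ _ P (X i) (EFin \o f)) ?f0 ?mule0//.
  exact/measurable_EFinP.
by apply: (@bounded_integrable _ _ _ _ (f \o X i) M);
  [exact: measurableT_comp|move=> w; exact: fM].
Qed.

Lemma iid_slln (f : T -> R) (M mu : R) :
  measurable_fun setT f -> (forall x, `|f x| <= M) ->
  (forall k, \int[P]_w (f (X k w))%:E = mu%:E)%E ->
  {ae P, forall w, (fun n => (\sum_(k < n) f (X k w)) / n%:R) @ \oo --> mu}.
Proof.
move=> mf fM fmu.
pose g x := f x - mu.
have mg : measurable_fun setT g by apply: measurable_funB.
have gM x : `|g x| <= M + `|mu| by rewrite (le_trans (ler_normB _ _))// lerD.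
have g0 k : (\int[P]_w (g (X k w))%:E = 0)%E.
  under eq_integral do rewrite /g EFinB.
  rewrite integralB//.
  - by rewrite fmu integral_cst//= probability_setT mule1 subee.
  - by apply: (@bounded_integrable _ _ _ _ (f \o X k) M);
      [exact: measurableT_comp|move=> w; exact: fM].
  - exact: (@bounded_integrable _ _ _ _ (cst mu) `|mu|).
have := @orthogonal_slln _ _ _ P (fun k w => g (X k w)) (M + `|mu|)
  (fun k => measurableT_comp mg (measurable_funPT (X k))) (fun k w => gM _)
  (fun i k ik => independent_orthogonal _ _ _ _ mg gM ik (g0 i)).
apply: filterS => w gw.
rewrite -[mu]add0r.
apply: cvg_trans (cvgD gw (@cvg_cst _ mu _ \oo _)).
apply: near_eq_cvg; near=> n.
rewrite addrfctE /g sumrB sumr_const card_ord mulrBl.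
rewrite -[mu *+ n]mulr_natr mulfK ?subrK//.
by rewrite pnatr_eq0 -lt0n; near: n; exact: nbhs_infty_gt.
Unshelve. all: by end_near.
Qed.

End IndependentSamples.

(** * Area of the plane under shears and rotations *)

Section Area.
Context {R : realType}.
Local Notation mu := (@lebesgue_measure R).

Lemma lebesgue_translation (a : R) (A : set (measurableTypeR R)) :
  measurable A -> mu ((fun y => y + a) @^-1` A) = mu A.
Proof.
pose t : measurableTypeR R -> measurableTypeR R := fun y => y + a.
have mt : measurable_fun setT t by apply: measurable_funD.
rewrite -[LHS]/(pushforward mu t A) => mA.
apply/esym/lebesgue_measure_unique => //= _ [[b c] _ <-].
rewrite /pushforward.
have -> : t @^-1` `]b, c]%classic = `]b - a, c - a]%classic.
  by apply/seteqP; split => y /=; rewrite !in_itv /= ltrBlDr lerBrDr.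
rewrite !lebesgue_measure_itv /= !lte_fin ltrD2r; case: ifP => // _.
by rewrite -!EFinD; congr EFin; lra.
Qed.

(** The product measure integrates vertical sections; by uniqueness it agrees
    with the measure that integrates horizontal ones. *)
Lemma area_ysection (E : set (plane R)) : measurable E ->
  area E = (\int[mu]_y mu (ysection E y))%E.
Proof.
move=> mE.
apply: (@product_measure_unique _ _ _ _ _ mu mu (mu \x^ mu)%E) => //.
move=> A B mA mB.
exact: product_measure2E.
Qed.

Definition vshear (a : R) (x : plane R) : plane R := (x.1, x.2 + a * x.1).
Definition hshear (a : R) (x : plane R) : plane R := (x.1 + a * x.2, x.2).

Lemma measurable_plane (f : plane R -> plane R) :
  measurable_fun setT (fst \o f) -> measurable_fun setT (snd \o f) ->
  measurable_fun setT f.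
Proof. by move=> m1 m2; apply/measurable_fun_pairP. Qed.

Lemma measurable_form (a b : R) :
  measurable_fun setT (fun x : plane R => a * x.1 + b * x.2).
Proof.
by apply: measurable_funD; apply: measurable_funM.
Qed.

Lemma measurable_vshear a : measurable_fun setT (vshear a).
Proof.
apply: measurable_plane => /=; first exact: measurable_fst.
apply: (eq_measurable_fun (fun x : plane R => a * x.1 + 1 * x.2)).
  by move=> x _; rewrite /= mul1r addrC.
exact: measurable_form.
Qed.

Lemma measurable_hshear a : measurable_fun setT (hshear a).
Proof.
apply: measurable_plane => /=; last exact: measurable_snd.
apply: (eq_measurable_fun (fun x : plane R => 1 * x.1 + a * x.2)).
  by move=> x _; rewrite /= mul1r.
exact: measurable_form.
Qed.

(** A shear translates each section parallel to its axis (Cavalieri). *)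
Lemma area_vshear a (E : set (plane R)) : measurable E ->
  area (vshear a @^-1` E) = area E.
Proof.
move=> mE; apply: eq_integral => x _ /=.
rewrite -[RHS](lebesgue_translation (a * x)); last exact: measurable_xsection.
by congr (mu _); apply/seteqP; split => y; rewrite /xsection /= !inE.
Qed.

Lemma area_hshear a (E : set (plane R)) : measurable E ->
  area (hshear a @^-1` E) = area E.
Proof.
move=> mE.
have mhE : measurable (hshear a @^-1` E).
  by rewrite -[X in measurable X]setTI; exact: measurable_hshear.
rewrite !area_ysection//; apply: eq_integral => y _ /=.
rewrite -[RHS](lebesgue_translation (a * y)); last exact: measurable_ysection.
by congr (mu _); apply/seteqP; split => x; rewrite /ysection /= !inE.
Qed.

(** Rotation of the plane by [2 pi / 3], in coordinates. *)
Definition rot (x : plane R) : plane R :=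
  (- (2^-1 * x.1) - Num.sqrt 3 / 2 * x.2, Num.sqrt 3 / 2 * x.1 - 2^-1 * x.2).

Lemma sqrt3_sqr : Num.sqrt 3 ^+ 2 = 3 :> R.
Proof. by rewrite sqr_sqrtr. Qed.

Lemma sqrt3_gt0 : 0 < Num.sqrt 3 :> R.
Proof. by rewrite sqrtr_gt0. Qed.

(** A rotation of angle [t] is a product of three shears, with coefficients
    [- tan (t / 2)], [sin t] and [- tan (t / 2)]. *)
Lemma rot_shears x :
  rot x = hshear (- Num.sqrt 3)
            (vshear (Num.sqrt 3 / 2) (hshear (- Num.sqrt 3) x)).
Proof.
rewrite /rot /hshear /vshear /=; have := sqrt3_sqr; set s := Num.sqrt 3 => s2.
(* The goals are linear in [x] once the powers of [s] are reduced. *)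
have sx : s ^+ 2 * x.1 = 3 * x.1 by rewrite s2.
have sy : s ^+ 2 * x.2 = 3 * x.2 by rewrite s2.
have ssy : s ^+ 3 * x.2 = 3 * s * x.2 by rewrite exprS s2 [s * 3]mulrC.
by congr pair; lra.
Qed.

Lemma measurable_rot : measurable_fun setT rot.
Proof.
rewrite (_ : rot = hshear (- Num.sqrt 3) \o vshear (Num.sqrt 3 / 2)
    \o hshear (- Num.sqrt 3)); last first.
  by apply/funext => x; rewrite rot_shears.
apply: measurableT_comp (measurable_hshear _).
exact: measurableT_comp (measurable_hshear _) (measurable_vshear _).
Qed.

Lemma area_rot (E : set (plane R)) : measurable E ->
  area (rot @^-1` E) = area E.
Proof.
move=> mE; set s := Num.sqrt 3 : R.
have mh : measurable (hshear (- s) @^-1` E).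
  by rewrite -[X in measurable X]setTI; exact: measurable_hshear.
have mv : measurable (vshear (s / 2) @^-1` (hshear (- s) @^-1` E)).
  by rewrite -[X in measurable X]setTI; exact: measurable_vshear.
rewrite -[RHS](area_hshear (- s))// -[RHS](area_vshear (s / 2))//.
rewrite -[RHS](area_hshear (- s))//.
by congr (area _); apply/seteqP; split => x; rewrite /= rot_shears.
Qed.

Lemma rot3 x : rot (rot (rot x)) = x.
Proof.
rewrite /rot /=; have := sqrt3_sqr; set s := Num.sqrt 3 => s2.
case: x => x y /=.
have sx : s ^+ 2 * x = 3 * x by rewrite s2.
have sy : s ^+ 2 * y = 3 * y by rewrite s2.
have ssx : s ^+ 3 * x = 3 * s * x by rewrite exprS s2 [s * 3]mulrC.
have ssy : s ^+ 3 * y = 3 * s * y by rewrite exprS s2 [s * 3]mulrC.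
by congr pair; lra.
Qed.

End Area.

(** * Geometry of the triangle and its cells *)

(** The three indices, in the form in which [big_ord_recl] produces them. *)
Local Notation v1 := (@ord0 2).
Local Notation v2 := (lift (@ord0 2) (@ord0 1)).
Local Notation v3 := (lift (@ord0 2) (lift (@ord0 1) (@ord0 0))).

Lemma ord3_ind (Q : 'I_3 -> Prop) :
  Q v1 -> Q v2 -> Q v3 -> forall l, Q l.
Proof.
move=> Q0 Q1 Q2; case=> [[|[|[|//]]] i3].
- by congr (Q _): Q0; apply: val_inj.
- by congr (Q _): Q1; apply: val_inj.
- by congr (Q _): Q2; apply: val_inj.
Qed.

Section Geometry.
Local Open Scope complex_scope.
Context {R : realType}.
Local Notation s := (Num.sqrt (3 : R)).
Local Notation lam := (@lambda R).

(** The cosine of a third of a full turn is a root, other than 1, of the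
    triplication polynomial [4 c ^ 3 - 3 c - 1 = (c - 1) (2 c + 1) ^ 2]. *)
Lemma cos_sin_2pi3 :
  cos (2 * pi / 3) = - 2^-1 :> R /\ sin (2 * pi / 3) = s / 2 :> R.
Proof.
set t : R := 2 * pi / 3.
have pi0 := pi_gt0 R.
have t3 : t + t + t = pi *+ 2 by rewrite /t; lra.
have c3 : cos (t + t + t) = 1 by rewrite t3 cos2pi.
have sc := cos2Dsin2 t.
have st : 0 < sin t by apply: sin_gt0_pi; rewrite /t; apply/andP; split; lra.
have ct1 : cos t != 1.
  by apply: contraTneq st => c1; rewrite -leNgt; move: sc; rewrite c1; nra.
move: c3; rewrite !(cosD, sinD) => c3.
have {}c3 : (cos t - 1) * (2 * cos t + 1) ^+ 2 = 0.
  have ssc : sin t * sin t * cos t = (1 - cos t ^+ 2) * cos t.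
    by congr (_ * _); rewrite -expr2 -sc; lra.
  lra.
have ct : cos t = - 2^-1.
  move/eqP: c3; rewrite mulf_eq0 subr_eq0 (negbTE ct1) /= expf_eq0 /=.
  by move=> /eqP; lra.
split=> //; apply/eqP.
rewrite -(eqrXn2 (n := 2))// ?ltW// ?divr_ge0 ?sqrtr_ge0//.
by rewrite expr_div_n sqrt3_sqr; apply/eqP; move: sc; rewrite ct; lra.
Qed.

Lemma jE : j = (- 2^-1 : R) +i* (s / 2).
Proof. by rewrite /j; case: cos_sin_2pi3 => -> ->. Qed.

Lemma lambda_gt0 : 0 < lam.
Proof. by rewrite mulr_gt0// invr_gt0 sqrtr_gt0 mulr_gt0// sqrt3_gt0. Qed.

Lemma lambda_sqr : lam ^+ 2 * (3 * s) = 4.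
Proof.
have s0 := @sqrt3_gt0 R.
rewrite /lambda exprMn exprVn sqr_sqrtr ?mulr_ge0 ?ltW//.
by field; rewrite gt_eqF.
Qed.

(** The scalar product of [x] with the unit vector pointing to [B l]. The
    geometry below is expressed by these three linear forms. *)
Definition toward (l : 'I_3) (x : plane R) : R :=
  [:: s / 2 * x.1 - x.2 / 2; x.2; - (s / 2 * x.1) - x.2 / 2]`_l.

Lemma BE (l : 'I_3) :
  B l = [:: (lam * (s / 2)) +i* (- (lam / 2)); 0 +i* lam;
            (- (lam * (s / 2))) +i* (- (lam / 2))]`_l.
Proof.
have B2E : B2 = 0 +i* lam by rewrite /B2; simpc.
rewrite /B B2E jE expr2.
have ssl : s ^+ 2 * lam = 3 * lam by rewrite sqrt3_sqr.
case: l => [[|[|[|//]]] ?] //=; simpc; congr (_ +i* _); lra.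
Qed.

(** All vertices have norm [lambda], so that comparing distances to the vertices
    amounts to comparing the forms [toward]. *)
Lemma dist_sqr l (x : plane R) :
  dist x l ^+ 2 = x.1 ^+ 2 + x.2 ^+ 2 + lam ^+ 2 - 2 * lam * toward l x.
Proof.
rewrite /dist normc_def sqr_sqrtr ?addr_ge0 ?sqr_ge0// BE.
have ssl : s ^+ 2 * lam ^+ 2 = 3 * lam ^+ 2 by rewrite sqrt3_sqr.
by rewrite /toward; case: l => [[|[|[|//]]] ?] /=; lra.
Qed.

Lemma dist_ge0 l (x : plane R) : 0 <= dist x l.
Proof. by rewrite /dist normc_def sqrtr_ge0. Qed.

Lemma dist_lt l m (x : plane R) :
  (dist x l < dist x m) = (toward m x < toward l x).
Proof.
rewrite -(ltr_pXn2r (n := 2)) ?nnegrE ?dist_ge0// !dist_sqr ltrD2l ltrN2.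
by rewrite ltr_pM2l// mulr_gt0// lambda_gt0.
Qed.

Lemma dist_le l m (x : plane R) :
  (dist x l <= dist x m) = (toward m x <= toward l x).
Proof. by rewrite !leNgt dist_lt. Qed.

(** The barycentric coordinate of [x] at [B l] is an increasing affine function
    of [toward l x], which vanishes where [toward l x] is [- lambda / 2]. *)
Lemma triangleP (x : plane R) :
  triangle x <-> forall l, - (lam / 2) <= toward l x.
Proof.
have l0 := lambda_gt0.
have ssl : s ^+ 2 * lam = 3 * lam by rewrite sqrt3_sqr.
split=> [[w [w0]]|h].
  rewrite !big_ord_recl !big_ord0 !BE /toC.
  set a := w _; set b := w _; set c' := w _ => w1.
  rewrite /=; simpc => -[x1E x2E] l.
  suff -> : toward l x = lam * (3 * w l - 1) / 2 by have := w0 l; nra.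
  have c'E : c' = 1 - a - b by lra.
  have sa : s ^+ 2 * (lam * a) = 3 * (lam * a) by rewrite sqrt3_sqr.
  have sb : s ^+ 2 * (lam * b) = 3 * (lam * b) by rewrite sqrt3_sqr.
  move: l; apply: ord3_ind; rewrite /toward x1E x2E /= -/a -/b -/c' c'E; lra.
exists (fun l => (2 * toward l x / lam + 1) / 3); split.
- move=> l; rewrite divr_ge0// -[X in _ + X](divff (lt0r_neq0 l0)).
  rewrite -mulrDl divr_ge0// ?(ltW l0)//.
  by have := h l; lra.
- by rewrite !big_ord_recl big_ord0 /toward /=; field; exact: lt0r_neq0.
- rewrite !big_ord_recl big_ord0 !BE /toC /toward /=; simpc.
  have xs : s ^+ 2 * x.1 = 3 * x.1 by rewrite sqrt3_sqr.
  congr (_ +i* _); last by field; exact: lt0r_neq0.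
  transitivity (s ^+ 2 * x.1 / 3); first by rewrite xs; field.
  by field; exact: lt0r_neq0.
Qed.

(** Multiplication by [j] cyclically permutes the vertices. *)
Lemma toward_rot (x : plane R) :
  [/\ toward v1 (rot x) = toward v3 x,
      toward v2 (rot x) = toward v1 x &
      toward v3 (rot x) = toward v2 x].
Proof.
rewrite /toward /rot /=.
have sx : s ^+ 2 * x.1 = 3 * x.1 by rewrite sqrt3_sqr.
have sy : s ^+ 2 * x.2 = 3 * x.2 by rewrite sqrt3_sqr.
by split; lra.
Qed.

Lemma triangle_rot (x : plane R) : triangle (rot x) <-> triangle x.
Proof.
have [e0 e1 e2] := toward_rot x.
split=> /triangleP h; apply/triangleP; apply: ord3_ind;
  by [rewrite -e1|rewrite -e2|rewrite -e0|rewrite e0|rewrite e1|rewrite e2].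
Qed.

Lemma costE (c : plane R -> R) (l : 'I_3) x :
  cost c l x = [:: c x; c (rot (rot x)); c (rot x)]`_l.
Proof.
have rotE (y : plane R) : ofC (j * toC y) = rot y.
  by rewrite jE /ofC /toC /rot; simpc; congr pair => /=; lra.
rewrite /cost; case: l => [[|[|[|//]]] ?] /=; rewrite -?rotE.
- by rewrite mul1r /ofC /toC /=; case: x.
- by congr (c _); rewrite expr2 -mulrA; congr ofC; congr (_ * _).
- by [].
Qed.

(** Being off the three bisectors. This excludes the rays at which the cells
    touch, so that untied points need no rule for breaking ties. *)
Definition untied (x : plane R) :=
  [/\ toward v1 x != toward v2 x,
      toward v2 x != toward v3 x & toward v3 x != toward v1 x].

Lemma untied_rot (x : plane R) : untied (rot x) <-> untied x.
Proof.
rewrite /untied; have [-> -> ->] := toward_rot x.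
by split=> -[? ? ?]; split.
Qed.

(** The ray that is removed from a cell lies on the bisector between its vertex
    and the next one. *)
Lemma ray_tied l (x : plane R) : ray l x -> ~ untied x.
Proof.
case=> t [_]; rewrite /toC jE => xE [n0 n1 n2]; move: l xE.
have st : s ^+ 2 * t = 3 * t by rewrite sqrt3_sqr.
have sst : s ^+ 3 * t = 3 * (s * t) by rewrite exprS sqrt3_sqr; ring.
have ssst : s ^+ 4 * t = 9 * t by rewrite (exprM _ 2 2) sqrt3_sqr; ring.
apply: ord3_ind; rewrite ?exprS ?expr0 /=; simpc => -[x1E x2E].
- by case/eqP: n0; rewrite /toward /= x1E x2E; lra.
- by case/eqP: n1; rewrite /toward /= x1E x2E; lra.
- by case/eqP: n2; rewrite /toward /= x1E x2E; lra.
Qed.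

Lemma bigmin_dist l (x : plane R) :
  dist x l = \big[Num.min/dist x 0]_m dist x m <->
  forall m, toward m x <= toward l x.
Proof.
split=> [e m|h].
  by rewrite -dist_le e; apply: bigmin_le_cond.
apply/le_anti/andP; split; last exact: bigmin_le_cond.
by apply: le_bigmin => [|m _]; rewrite dist_le.
Qed.

Lemma cellP l (x : plane R) : untied x ->
  cell l x <-> triangle x /\ forall m, toward m x <= toward l x.
Proof.
move=> ux; split=> [[[tx /bigmin_dist h] _]//|[tx /bigmin_dist h]].
by split => // /ray_tied.
Qed.

End Geometry.

(** * Measure of the triangle and of its cells *)

Section CellMeasure.
Local Open Scope complex_scope.
Context {R : realType}.
Local Notation s := (Num.sqrt (3 : R)).
Local Notation lam := (@lambda R).
Local Notation mu := (@lebesgue_measure R).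

Lemma measurable_toward (l : 'I_3) : measurable_fun setT (@toward R l).
Proof.
move: l; apply: ord3_ind.
- apply: (eq_measurable_fun (fun x : plane R => s / 2 * x.1 + (- 2^-1) * x.2)).
    by move=> x _; rewrite /toward /=; lra.
  exact: measurable_form.
- exact: measurable_snd.
- apply: (eq_measurable_fun
    (fun x : plane R => (- (s / 2)) * x.1 + (- 2^-1) * x.2)).
    by move=> x _; rewrite /toward /=; lra.
  exact: measurable_form.
Qed.

Lemma measurable_triangle : measurable (@triangle R).
Proof.
rewrite (_ : triangle =
    \bigcap_(l in [set: 'I_3]) (toward l @^-1` `[- (lam / 2), +oo[)).
  apply: fin_bigcap_measurable => // l _.
  by rewrite -[X in measurable X]setTI; exact: measurable_toward.
apply/seteqP; split => x.
  by move=> /triangleP h l _ /=; rewrite in_itv /= andbT.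
by move=> h; apply/triangleP => l; have := h l I; rewrite /= in_itv /= andbT.
Qed.

Definition bisector (l m : 'I_3) : set (plane R) :=
  [set x | toward l x = toward m x].

Lemma measurable_bisector (l m : 'I_3) : measurable (bisector l m).
Proof.
rewrite (_ : bisector l m = (toward l \- toward m) @^-1` [set 0]).
  rewrite -[X in measurable X]setTI.
  by apply: measurable_funB => //; exact: measurable_toward.
by apply/seteqP; split => x /= => [->|/eqP]; rewrite ?subrr// subr_eq0 => /eqP.
Qed.

Lemma measurable_ray0 : measurable (@ray R v1).
Proof.
rewrite (_ : ray v1 = bisector v1 v2
    `&` (toward v2 @^-1` `]0, +oo[)).
  apply: measurableI; first exact: measurable_bisector.
  by rewrite -[X in measurable X]setTI; exact: measurable_toward.
apply/seteqP; split => x.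
  case=> t [/= t0]; rewrite /toC jE expr1 /=; simpc => -[x1E x2E].
  have st : s ^+ 2 * t = 3 * t by rewrite sqrt3_sqr.
  by split; rewrite /bisector /toward /= ?in_itv /= ?x1E x2E ?andbT; lra.
case; rewrite /bisector /toward /= in_itv /= andbT => e x2.
(* The second coordinate of ['i * j * t] is [- t / 2]. *)
exists (- (2 * x.2)); split; first by rewrite /=; lra.
rewrite /toC jE expr1 /=; simpc.
have s0 := @sqrt3_gt0 R.
have sx : s ^+ 2 * x.1 = 3 * x.1 by rewrite sqrt3_sqr.
have e' : s ^+ 2 * x.1 = 3 * (s * x.2).
  rewrite expr2 -mulrA (_ : s * x.1 = 3 * x.2); last by lra.
  by ring.
by congr (_ +i* _); lra.
Qed.

Lemma measurable_cell0 : measurable (@cell R v1).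
Proof.
apply: measurableD measurable_ray0.
rewrite (_ : [set x | _] = triangle `&`
    \bigcap_(m in [set: 'I_3]) [set x | toward m x <= toward v1 x]); last first.
  apply/seteqP; split => x /= [tx].
    by move=> /bigmin_dist h; split => // m _; exact: h.
  by move=> h; split => //; apply/bigmin_dist => m; exact: h.
apply: measurableI; first exact: measurable_triangle.
apply: fin_bigcap_measurable => // m _.
rewrite (_ : [set x | _] = (toward m \- toward v1) @^-1` `]-oo, 0]).
  rewrite -[X in measurable X]setTI.
  by apply: measurable_funB => //; exact: measurable_toward.
by apply/seteqP; split => x /=; rewrite in_itv /= subr_le0.
Qed.

(** One bisector is the line [x.1 = 0]; the other two are rotated copies. *)
Lemma area_bisectors :
  [/\ area (bisector v1 v2) = 0%E, area (bisector v2 v3) = 0%E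
    & area (bisector v3 v1) = 0%E].
Proof.
have symE l m : bisector l m = bisector m l by apply/seteqP; split => x /=.
have a13 : area (bisector v1 v3) = 0%E.
  rewrite (_ : bisector v1 v3 = [set 0] `*` setT).
    have -> : area ([set 0] `*` setT) = (mu [set 0%R] * mu setT)%E.
      by apply: product_measure1E => //; exact: measurable_set1.
    by rewrite [X in (X * _)%E]lebesgue_measure_set1 mul0e.
  have s0 := @sqrt3_gt0 R.
  apply/seteqP; split => [x|x [/= x1 _]]; rewrite /bisector /toward /=;
    last by rewrite x1; lra.
  by move=> e; split => //=; nra.
have a21 : area (bisector v2 v1) = 0%E.
  rewrite -area_rot; last exact: measurable_bisector.
  rewrite (_ : _ @^-1` _ = bisector v1 v3)//.
  by apply/seteqP; split => x /=; have [e0 e1 e2] := toward_rot x;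
    rewrite /bisector /= e0 e1.
have a32 : area (bisector v3 v2) = 0%E.
  rewrite -area_rot; last exact: measurable_bisector.
  rewrite (_ : _ @^-1` _ = bisector v2 v1)//.
  by apply/seteqP; split => x /=; have [e0 e1 e2] := toward_rot x;
    rewrite /bisector /= e1 e2.
by split; rewrite symE.
Qed.

(** The horizontal section at height [y] is an interval centred at 0, which
    shrinks linearly from the base [y = - lambda / 2] to the top vertex. *)
Lemma mu_ysection_triangle (y : R) :
  mu (ysection (@triangle R) y)
  = (((fun y => (2 * (lam - y) / s)%:E) \_ `[- (lam / 2), lam]) y : \bar R).
Proof.
have s0 := @sqrt3_gt0 R; have l0 := @lambda_gt0 R.
have [yl|yl] := ltP y (- (lam / 2)).
  rewrite patchE ifF; last first.
    by apply/negbTE/negP; rewrite inE /= in_itv /= => /andP[]; lra.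
  rewrite (_ : ysection _ _ = set0) ?measure0//.
  apply/seteqP; split => x //; rewrite /ysection /= inE => /triangleP.
  by move=> /(_ v2); rewrite /toward /=; lra.
rewrite (_ : ysection _ _ = `[- ((lam - y) / s), (lam - y) / s]%classic);
  last first.
  apply/seteqP; split => x; rewrite /ysection /= inE in_itv /=.
    move=> /triangleP h; rewrite -mulNr ler_pdivrMr// ler_pdivlMr//.
    have := h v1; have := h v3; rewrite /toward /=.
    by move=> h2 h0; apply/andP; split; lra.
  rewrite -mulNr ler_pdivrMr// ler_pdivlMr// => /andP[h0 h2].
  by apply/triangleP; apply: ord3_ind; rewrite /toward /=; lra.
rewrite lebesgue_measure_itv /= lte_fin patchE.
have [ly|ly] := ltP lam y.
  rewrite ifF; last first.
    apply/negbTE; rewrite -leNgt ler_pdivrMr// -mulNr divfK ?gt_eqF//; lra.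
  by rewrite ifF//; apply/negbTE/negP; rewrite inE /= in_itv /= => /andP[]; lra.
rewrite [RHS]ifT; last by rewrite inE /= in_itv /= yl ly.
have [e|ne] := eqVneq lam y.
  by rewrite e subrr mul0r oppr0 ltxx mulr0 mul0r.
rewrite ifT; last first.
  have : 0 < (lam - y) / s by rewrite divr_gt0// subr_gt0 lt_neqAle eq_sym ne.
  lra.
by rewrite -EFinD; congr EFin; field; rewrite gt_eqF.
Qed.

Lemma area_triangle : area (@triangle R) = 1%E.
Proof.
have s0 := @sqrt3_gt0 R; have l0 := @lambda_gt0 R.
rewrite area_ysection; last exact: measurable_triangle.
under eq_integral do rewrite mu_ysection_triangle.
rewrite -integral_mkcond.
pose F (y : R) := - ((lam - y) ^+ 2 / s).
have dF (y : R) : is_derive y 1 F (2 * (lam - y) / s).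
  rewrite /F; apply: is_derive_eq.
  by rewrite !scaler0 /GRing.scale /=; field; rewrite gt_eqF.
have cF : continuous F.
  by move=> y; apply/differentiable_continuous/derivable1_diffP.
have cf : continuous (fun y : R => 2 * (lam - y) / s).
  move=> y; apply: cvgM; last exact: cvg_cst.
  by apply: cvgM; [exact: cvg_cst|apply: cvgB; [exact: cvg_cst|exact: cvg_id]].
rewrite (@continuous_FTC2 R _ F).
- rewrite -EFinB /F subrr; congr EFin.
  have l2 : lam ^+ 2 = 4 * s / 9.
    have : lam ^+ 2 * (3 * s) * s = 4 * s by rewrite lambda_sqr.
    have : s ^+ 2 * lam ^+ 2 = 3 * lam ^+ 2 by rewrite sqrt3_sqr.
    lra.
  have -> : - (0 ^+ 2 / s) - - ((lam - - (lam / 2)) ^+ 2 / s)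
    = 9 / 4 * lam ^+ 2 / s by field; rewrite gt_eqF.
  by rewrite l2; field; rewrite gt_eqF.
- lra.
- exact: continuous_subspaceT.
- split.
  + by move=> y _; exact: ex_derive.
  + exact/cvg_at_right_filter/cF.
  + exact/cvg_at_left_filter/cF.
- by move=> y _; rewrite derive1E derive_val.
Qed.

End CellMeasure.

(** * Optimal and suboptimal loads *)

(** Both sides are sums over all pairs [(l, m)] with the weights [b l * a m], of
    [F l] on the left and of [F m] on the right. *)
Lemma weighted_min_le (R : numDomainType) (I : finType) (F : I -> R)
    (a b : I -> bool) :
  (\sum_l (a l : nat) = 1)%N -> (\sum_l (b l : nat) = 1)%N ->
  (forall l m, b l -> F l <= F m) ->
  \sum_l (b l)%:R * F l <= \sum_l (a l)%:R * F l.
Proof.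
move=> a1 b1 bF.
have -> : \sum_l (b l)%:R * F l = \sum_l \sum_m (b l)%:R * (a m)%:R * F l.
  apply: eq_bigr => l _; rewrite -mulr_suml -mulr_sumr -natr_sum a1.
  by rewrite mulr1.
have -> : \sum_m (a m)%:R * F m = \sum_l \sum_m (b l)%:R * (a m)%:R * F m.
  rewrite exchange_big; apply: eq_bigr => m _.
  by rewrite -mulr_suml -mulr_suml -natr_sum b1 mul1r.
apply: ler_sum => l _; apply: ler_sum => m _.
case: (b l) (bF l m) => [bF'|_]; last by rewrite !mul0r.
by apply: ler_wpM2l; rewrite ?mulr_ge0 ?ler0n ?bF'.
Qed.

Section LoadBounds.
Context {R : realType}.
Variable c : plane R -> R.
Hypothesis c_closest : forall (x : plane R) (l : 'I_3), triangle x -> l != 0 ->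
  dist x 0 < dist x l -> cost c 0 x < cost c l x.

(** Three distinct numbers have exactly one maximum. *)
Lemma cell_count (x : plane R) : untied x -> triangle x ->
  (\sum_l ((x \in cell l) : nat) = 1)%N.
Proof.
move=> ux tx.
have cE l : (x \in cell l) = [forall m, toward m x <= toward l x].
  apply/idP/forallP => [|h]; rewrite inE; first by move=> /(cellP _ _ ux)[].
  by apply/(cellP _ _ ux); split.
rewrite !big_ord_recl big_ord0 !cE.
have fE l : [forall m, toward m x <= toward l x] =
    [&& toward v1 x <= toward l x, toward v2 x <= toward l x &
    toward v3 x <= toward l x].
  apply/forallP/and3P => [h|[h0 h1 h2]]; first by split; exact: h.
  exact: ord3_ind.
rewrite !fE !lexx !andbT.
case: ux => n0 n1 n2; move: n0 n1 n2.
set p := toward _ _; set q := toward _ x; set r := toward _ x.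
case: (ltgtP p q) => // pq _; case: (ltgtP q r) => // qr _;
  case: (ltgtP r p) => // rp _; exfalso; lra.
Qed.

(** The hypothesis speaks of the first cell; rotating the point by one or two
    thirds of a turn carries it to the other two cells. *)
Lemma cost_cell_le (x : plane R) l m : untied x -> cell l x ->
  cost c l x <= cost c m x.
Proof.
move=> ux /(cellP _ _ ux)[tx h].
have [->//|ml] := eqVneq m l.
have t1 := proj2 (triangle_rot x) tx.
have t2 := proj2 (triangle_rot (rot x)) t1.
have [n0 n1 n2] := ux.
have lt i k : toward i x <= toward k x -> toward i x != toward k x ->
  toward i x < toward k x by move=> ik ne; rewrite lt_neqAle ne.
have [e0 e1 e2] := toward_rot x; have [f0 f1 f2] := toward_rot (rot x).
have near (y : plane R) i : triangle y -> i != 0 -> toward i y < toward 0 y ->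
    cost c 0 y <= cost c i y.
  by move=> ty i0 ty'; apply/ltW/c_closest => //; rewrite dist_lt.
have := h v1; have := h v2; have := h v3.
move: l m ml h => l m ml _; move: l m ml.
apply: ord3_ind; apply: ord3_ind => // _ h2 h1 h0.
- by apply: near => //; apply: lt => //; rewrite eq_sym.
- by apply: near => //; apply: lt.
- have := near _ v3 t2 isT.
  by rewrite f0 f2 e2 e1 !costE /= rot3; apply; exact: lt.
- have := near _ v2 t2 isT.
  by rewrite f0 f1 e2 e0 !costE /= rot3; apply; apply: lt => //; rewrite eq_sym.
- have := near _ v2 t1 isT.
  by rewrite e0 e1 !costE /= rot3; apply; apply: lt => //; rewrite eq_sym.
- have := near _ v3 t1 isT.
  by rewrite e0 e2 !costE /=; apply; exact: lt.
Qed.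

(** What the assignment by cells charges to server [l] for the point [x] is a
    rotated copy of one and the same function, the cost cut off outside the
    first cell. *)
Lemma cost_cell (x : plane R) l : untied x -> triangle x ->
  (x \in cell l)%:R * cost c l x = cost (c \_ (cell v1)) l x.
Proof.
move=> ux tx.
have t1 := proj2 (triangle_rot x) tx.
have t2 := proj2 (triangle_rot (rot x)) t1.
have u1 := proj2 (untied_rot x) ux.
have u2 := proj2 (untied_rot (rot x)) u1.
have [e0 e1 e2] := toward_rot x; have [f0 f1 f2] := toward_rot (rot x).
have patchM (b : bool) (v : R) : b%:R * v = if b then v else 0.
  by case: b; rewrite ?mul1r ?mul0r.
move: l; apply: ord3_ind; rewrite !costE /= !patchE patchM; first by [].
- congr (if _ then _ else _); apply/idP/idP; rewrite !inE.
    move=> /(cellP _ _ ux)[_ h]; apply/(cellP _ _ u2); split => //.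
    by apply: ord3_ind; rewrite ?f0 ?f1 ?f2 ?e0 ?e1 ?e2; exact: h.
  move=> /(cellP _ _ u2)[_ h]; apply/(cellP _ _ ux); split => //.
  have := h v1; have := h v2; have := h v3.
  by rewrite f0 f1 f2 e0 e1 e2 => ? ? ?; exact: ord3_ind.
- congr (if _ then _ else _); apply/idP/idP; rewrite !inE.
    move=> /(cellP _ _ ux)[_ h]; apply/(cellP _ _ u1); split => //.
    by apply: ord3_ind; rewrite ?e0 ?e1 ?e2; exact: h.
  move=> /(cellP _ _ u1)[_ h]; apply/(cellP _ _ ux); split => //.
  have := h v1; have := h v2; have := h v3.
  by rewrite e0 e1 e2 => ? ? ?; exact: ord3_ind.
Qed.

Variable x : nat -> plane R.
Hypothesis x_untied : forall k, untied (x k).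
Hypothesis x_triangle : forall k, triangle (x k).

(** The largest of three loads is at least their mean, and the total load is
    smallest when every point goes to a server which it costs least. *)
Lemma load_bounds n (a e : R) :
  (forall l, `|a - \sum_(k < n) cost (c \_ (cell v1)) l (x k)| <= e) ->
  a - e <= opt_load c x n /\ opt_load c x n <= subopt_load c x n
  /\ subopt_load c x n <= a + e.
Proof.
move=> near_a.
have loadE l : load c x (cell_assignment x n) l
    = \sum_(k < n) cost (c \_ (cell v1)) l (x k).
  by apply: eq_bigr => k _; rewrite mxE cost_cell.
have cellA : cell_assignment x n \in assignments n.
  rewrite inE; apply/forallP => k; apply/eqP.
  rewrite -[RHS](cell_count _ (x_untied k) (x_triangle k)).
  by apply: eq_bigr => l _; rewrite mxE.
have load_le (A : 'M[bool]_(n, 3)) l : load c x A l <= max_load c x A.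
  exact: le_bigmax_cond.
have lower (A : 'M[bool]_(n, 3)) :
    A \in assignments n -> a - e <= max_load c x A.
  rewrite inE => /forallP A1.
  have : \sum_l load c x (cell_assignment x n) l <= \sum_l load c x A l.
    rewrite exchange_big [leRHS]exchange_big; apply: ler_sum => k _.
    under eq_bigr do rewrite mxE.
    apply: (weighted_min_le _ _ (fun l => cost c l (x k)) (A k)
      (fun l => x k \in cell l)).
    - exact/eqP/A1.
    - exact: cell_count.
    - by move=> l m; rewrite inE; exact: cost_cell_le.
  rewrite !big_ord_recl !big_ord0 !loadE => tot.
  have := load_le A v1; have := load_le A v2; have := load_le A v3.
  have := near_a v1; have := near_a v2; have := near_a v3.
  rewrite !ler_norml => /andP[? ?] /andP[? ?] /andP[? ?]; lra.
split; last split.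
- apply: le_bigmin => [|A]; last exact: lower.
  by apply: lower; exact: all_to_first_assignment.
- exact: bigmin_le_cond.
- have up l : load c x (cell_assignment x n) l <= a + e.
    by have := near_a l; rewrite loadE ler_norml => /andP[? ?]; lra.
  by apply: bigmax_le.
Qed.

End LoadBounds.

(** * Expected loads and the limit theorem *)

Lemma ge0_integral_rot (R : realType) (f : plane R -> \bar R) :
  measurable_fun setT f -> (forall x, 0 <= f x)%E ->
  (\int[area]_x f (rot x) = \int[area]_x f x)%E.
Proof.
move=> mf f0.
transitivity (\int[pushforward area rot]_x f x)%E.
  apply/esym.
  exact: (@ge0_integral_pushforward _ _ _ _ _ _ measurable_rot area setT f
    measurableT mf (fun y _ => f0 y)).
apply: eq_measure_integral => [|mr E mE _]; first exact: measurable_rot.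
exact: area_rot.
Qed.

Section UniformSample.
Context {R : realType} d (Omega : measurableType d) (P : probability Omega R).
Variable X : {RV P >-> plane R}.
Hypothesis X_unif : uniform_on triangle X.

(** The factor [area triangle] of a uniform law disappears, being 1. *)
Lemma uniform_triangleE (E : set (plane R)) : measurable E ->
  P (X @^-1` E) = area (E `&` triangle).
Proof. by move=> mE; rewrite X_unif// area_triangle inve1 mule1. Qed.

Lemma ge0_expectation_uniform (f : plane R -> \bar R) :
  measurable_fun setT f -> (forall x, 0 <= f x)%E ->
  (forall x, ~ triangle x -> f x = 0)%E ->
  (\int[P]_w f (X w) = \int[area]_x f x)%E.
Proof.
move=> mf f0 f_out.
have -> : f = f \_ triangle.
  apply/funext => x; rewrite patchE; case: ifPn => //.
  by rewrite notin_setE => /f_out.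
rewrite -(ge0_integral_distribution X (f := f \_ triangle)).
- rewrite -!integral_mkcond; apply: eq_measure_integral => E mE tE.
  by rewrite /= [LHS]uniform_triangleE// setIidl.
- apply/(measurable_restrictT _ measurable_triangle).
  exact: measurable_funTS.
- by move=> x; rewrite patchE; case: ifP.
Qed.

Lemma ae_untied_triangle : {ae P, forall w, untied (X w) /\ triangle (X w)}.
Proof.
pose ties : set (plane R) :=
  bisector v1 v2 `|` bisector v2 v3 `|` bisector v3 v1.
pose E : set (plane R) := ~` triangle `|` ties.
have mL l m : measurable (@bisector R l m) by exact: measurable_bisector.
have mE : measurable E.
  apply: measurableU; first exact: measurableC measurable_triangle.
  by apply: measurableU => //; exact: measurableU.
have [a12 a23 a31] := @area_bisectors R.
exists (X @^-1` E); split.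
- by rewrite -[X in measurable X]setTI; exact: measurable_funPT.
- rewrite uniform_triangleE//; apply: measure_negligible.
    by apply: measurableI => //; exact: measurable_triangle.
  apply: (@negligibleS _ _ _ area ties).
    by move=> x [[//|]].
  exact: (negligibleU (negligibleU (proj2 (negligibleP _ (mL _ _)) a12)
    (proj2 (negligibleP _ (mL _ _)) a23)) (proj2 (negligibleP _ (mL _ _)) a31)).
- move=> w /= h; apply: contrapT => nE; apply: h.
  have tx : triangle (X w) by apply: contrapT => ntx; apply: nE; left.
  have nL : ~ ties (X w) by move=> tied; apply: nE; right.
  split => //; split; apply/eqP => e; apply: nL.
  + by left; left.
  + by left; right.
  + by right.
Qed.

End UniformSample.

Section CellCost.
Context {R : realType}.
Variables (c : plane R -> R) (M : R).
Hypothesis c_meas : measurable_fun triangle c.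
Hypothesis c_ge0 : forall x, triangle x -> 0 <= c x.
Hypothesis c_le : forall x, triangle x -> c x <= M.
Local Notation g := (c \_ (cell v1)).

Lemma cell_cost_ge0 x : 0 <= g x.
Proof. by rewrite patchE; case: ifPn => // /set_mem[[/c_ge0]]. Qed.

Lemma cell_cost_out x : ~ triangle x -> g x = 0.
Proof. by move=> tx; rewrite patchE; case: ifPn => // /set_mem[[]]. Qed.

Lemma cell_cost_bounded l x : `|cost g l x| <= `|M|.
Proof.
have gM y : `|g y| <= `|M|.
  rewrite patchE; case: ifPn => [/set_mem[[ty _] _]|_]; last by rewrite normr0.
  by rewrite ger0_norm ?c_ge0// (le_trans (c_le _ ty))// ler_norm.
by rewrite costE; case: l => [[|[|[|//]]] ?]; exact: gM.
Qed.

Lemma measurable_cell_cost l : measurable_fun setT (cost g l).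
Proof.
have mg : measurable_fun setT g.
  apply/(measurable_restrictT _ measurable_cell0).
  by apply: measurable_funS c_meas; [exact: measurable_triangle|move=> x [[]]].
have mr := @measurable_rot R.
move: l; apply: ord3_ind.
- by apply: eq_measurable_fun mg => x _; rewrite costE.
- apply: (eq_measurable_fun (g \o (rot \o rot))).
    by move=> x _; rewrite costE.
  by apply: measurableT_comp mg _; exact: (measurableT_comp mr mr).
- apply: (eq_measurable_fun (g \o rot)); first by move=> x _; rewrite costE.
  exact: measurableT_comp mg mr.
Qed.

(** All three loads have the same mean, by rotation invariance of the area. *)
Lemma expectation_cell_cost d (Omega : measurableType d)
    (P : probability Omega R) (X : {RV P >-> plane R}) l :
  uniform_on triangle X ->
  (\int[P]_w (cost g l (X w))%:E
   = (\int[area]_(x in cell v1) c x)%R%:E)%E.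
Proof.
move=> X_unif.
pose f x : \bar R := (g x)%:E.
have mcost k : measurable_fun setT (EFin \o cost g k).
  by apply/measurable_EFinP; exact: measurable_cell_cost.
have mf : measurable_fun setT f.
  by apply: eq_measurable_fun (mcost v1) => x _; rewrite /= costE.
have f0 x : (0 <= f x)%E by rewrite lee_fin cell_cost_ge0.
have mfr : measurable_fun setT (f \o rot) := measurableT_comp mf measurable_rot.
have fr : (\int[area]_x f (rot x) = \int[area]_x f x)%E.
  exact: ge0_integral_rot.
have frr : (\int[area]_x f (rot (rot x)) = \int[area]_x f x)%E.
  by rewrite -fr; apply: (ge0_integral_rot _ (f \o rot)) => // x; exact: f0.
have Ef k : (\int[P]_w (cost g k (X w))%:E = \int[area]_x f x)%E.
  rewrite (@ge0_expectation_uniform _ _ _ P X X_unif (EFin \o cost g k))//.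
  - move: k; apply: ord3_ind => /=; under eq_integral do rewrite costE /=.
    + by [].
    + exact: frr.
    + exact: fr.
  - move=> x /=; rewrite lee_fin costE.
    by case: k => [[|[|[|//]]] ?]; exact: cell_cost_ge0.
  - move=> x tx /=; rewrite costE; congr EFin.
    have t1 : ~ triangle (rot x) by move=> /triangle_rot.
    have t2 : ~ triangle (rot (rot x)) by move=> /triangle_rot.
    by case: k => [[|[|[|//]]] ?]; exact: cell_cost_out.
rewrite Ef /Rintegral integral_mkcond restrict_EFin fineK//.
rewrite -/f -(Ef v1).
apply: integrable_fin_num => //.
apply: (bounded_integrable _ _ _ _ (cost g v1 \o X) `|M|).
  exact: measurableT_comp (measurable_cell_cost _) _.
by move=> w; exact: cell_cost_bounded.
Qed.

End CellCost.

Theorem theorem1p1 (R : realType) (d : measure_display)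
    (Omega : measurableType d) (P : probability Omega R)
    (X : nat -> {RV P >-> plane R}) (c : plane R -> R)
    (X_indep : mutually_independent X)
    (X_unif : forall k, uniform_on triangle (X k))
    (c_meas : measurable_fun triangle c)
    (c_ge0 : forall x, triangle x -> 0 <= c x)
    (c_bounded : has_ubound [set c x | x in triangle])
    (c_closest : forall (x : plane R) (l : 'I_3), triangle x -> l != 0 ->
       dist x 0 < dist x l -> cost c 0 x < cost c l x) :
  let gamma : R := \int[area]_(x in cell 0) c x in
  {ae P, forall w : Omega,
     ((fun n => opt_load c (X^~ w) n / n%:R) @ \oo --> gamma) /\
     ((fun n => subopt_load c (X^~ w) n / n%:R) @ \oo --> gamma)}.
Proof.
move=> gamma.
have [M Mub] := c_bounded.
have c_le x : triangle x -> c x <= M by move=> tx; apply: Mub; exists x.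
have good : {ae P, forall w k, untied (X k w) /\ triangle (X k w)}.
  by apply: ae_foralln => k; exact: ae_untied_triangle.
have slln l : {ae P, forall w,
    (fun n => (\sum_(k < n) cost (c \_ (cell v1)) l (X k w)) / n%:R) @ \oo
      --> gamma}.
  apply: (@iid_slln _ _ _ _ _ _ X X_indep (cost (c \_ (cell v1)) l) `|M|).
  - exact: measurable_cell_cost.
  - by move=> x; apply: cell_cost_bounded.
  - by move=> k; apply: (expectation_cell_cost _ M).
have slln3 : {ae P, forall w l,
    (fun n => (\sum_(k < n) cost (c \_ (cell v1)) l (X k w)) / n%:R) @ \oo
      --> gamma}.
  apply: (filterS3 _ _ (slln v1) (slln v2) (slln v3)) => w s0 s1 s2.
  exact: ord3_ind.
apply: (filterS2 _ _ good slln3) => w Xw cvg_loads.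
(* Both loads are caught in the same interval around [gamma]. *)
have near_gamma (e : R) : 0 < e -> \forall n \near \oo,
    gamma - e <= opt_load c (X^~ w) n / n%:R
    /\ opt_load c (X^~ w) n / n%:R <= subopt_load c (X^~ w) n / n%:R
    /\ subopt_load c (X^~ w) n / n%:R <= gamma + e.
  move=> e0.
  have close l := (cvgrPdist_le _ _).1 (cvg_loads l) _ e0.
  near=> n.
  have n0 : 0 < n%:R :> R by rewrite ltr0n; near: n; exact: nbhs_infty_gt.
  have close_n l :
      `|gamma * n%:R - \sum_(k < n) cost (c \_ (cell v1)) l (X k w)|
        <= e * n%:R.
    have : `|gamma - (\sum_(k < n) cost (c \_ (cell v1)) l (X k w)) / n%:R|
        <= e.
      move: l; apply: ord3_ind; near: n; exact: close.
    rewrite -(ler_pM2r n0) -{2}(gtr0_norm n0) -normrM mulrBl divfK//.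
    by rewrite gt_eqF.
  have := load_bounds c c_closest (X^~ w) (fun k => (Xw k).1)
    (fun k => (Xw k).2) _ _ _ close_n.
  rewrite -mulrBl -mulrDl ler_pdivlMr// !ler_pdivrMr// divfK ?gt_eqF//.
split; apply/cvgrPdist_le => e e0; have := near_gamma e e0; apply: filterS => n;
  by rewrite ler_norml => -[? [? ?]]; apply/andP; split; lra.
Unshelve. all: by end_near.
Qed.
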